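(* Let $q=3$, let $n\ge 6$ be an integer, and let $t=\lceil\log_2 n\rceil$. Then for every integer $a$ with $0\le a\le n-1$ and every $b\in\mathbb{Z}_3$, $$|\mathcal{VT}_{a,b}(n)|\ \ge\ 2^{2(t-3)}\,3^{\,n-3t+3}.$$
   Context: $\mathbb{Z}_3=\{0,1,2\}$ is the ring of integers modulo $3$, with its elements ordered naturally $0<1<2$. For a sequence $S=s_0s_1\cdots s_{n-1}\in\mathbb{Z}_3^n$, the auxiliary binary sequence $A_S=\alpha_1\alpha_2\cdots\alpha_{n-1}$ of length $n-1$ is defined by $\alpha_i=1$ if $s_i\ge s_{i-1}$ and $\alpha_i=0$ if $s_i<s_{i-1}$, for $1\le i\le n-1$. Its VT syndrome is $\mathsf{syn}(A_S)=\sum_{i=1}^{n-1} i\,\alpha_i \bmod n$, an element of $\{0,\dots,n-1\}$. The modular sum is $\mathsf{sum}(S)=\sum_{i=0}^{n-1}s_i \bmod 3$. For $0\le a\le n-1$ and $b\in\mathbb{Z}_3$, the ternary Varshamov–Tenengolts code of length $n$ with parameters $(a,b)$ is $$\mathcal{VT}_{a,b}(n)=\{S\in\mathbb{Z}_3^n:\ \mathsf{syn}(A_S)=a,\ \mathsf{sum}(S)=b\}.$$ *)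

(* Defs.v *)
From mathcomp Require Import all_boot all_order all_algebra.
Set Implicit Arguments.
Unset Strict Implicit.
Unset Printing Implicit Defensive.
Import GRing.Theory.
Local Open Scope ring_scope.

(* alpha_1 ... alpha_(n-1); entries are numbered from 0, so alpha_(i+1) is
   the entry of index i. The comparison is that of the representatives
   0 < 1 < 2 in nat. *)
Definition auxseq (n : nat) (S : n.-tuple 'Z_3) : (n.-1).-tuple bool :=
  [tuple (nth 0%R S i <= nth 0%R S i.+1)%N | i < n.-1].

(* The modulus is the length of the binary word plus one. *)
Definition syn (m : nat) (A : m.-tuple bool) : nat :=
  ((\sum_(i < m) i.+1 * tnth A i) %% m.+1)%N.

Definition modsum (n : nat) (S : n.-tuple 'Z_3) : 'Z_3 := \sum_(s <- S) s.

Definition VT (n a : nat) (b : 'Z_3) : {set n.-tuple 'Z_3} :=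
  [set S : n.-tuple 'Z_3 | (syn (auxseq S) == a) && (modsum S == b)].

(* Main.v *)
Require Import Defs.
From mathcomp Require Import all_boot all_order all_algebra.
From mathcomp Require Import zify ring.
Import GRing.Theory.
Local Open Scope ring_scope.

(** Build words from left to right as families indexed by a finite set of
    messages, keeping for every message enough freedom to realise any modular
    sum together with any of [L] consecutive values of the unreduced syndrome.
    Appending a free symbol multiplies the number of messages by 3. Appending
    [p x q] with [(p, q)] one of (1,1), (1,2), (2,0), (2,2) multiplies it by 4:
    for those four pairs, some two values of [x] give different comparisons
    [p <= x] but the same comparison [x <= q], so that the choice of [x]
    controls exactly one term of the syndrome and [L] grows by its index. Six
    initial symbols give [L = 8], and about one block [p x q] for each power of
    two between 8 and [n] brings [L] up to [n], so that every message yields a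
    codeword, whatever the parameters of the code. *)

Definition weight (S : seq 'Z_3) : nat :=
  (\sum_(i < (size S).-1) i.+1 * (nth 0%R S i <= nth 0%R S i.+1))%N.

Lemma weight_rcons (S : seq 'Z_3) (s : 'Z_3) : (0 < size S)%N ->
  weight (rcons S s) = (weight S + size S * (last 0%R S <= s))%N.
Proof.
rewrite /weight size_rcons; case E: (size S) => [|m] //= _.
rewrite big_ord_recr /= !nth_rcons E ltnn eqxx ltnSn -nth_last E /=.
congr (_ + _)%N; apply: eq_bigr => i _; rewrite !nth_rcons E.
by rewrite ltnS (ltnW (ltn_ord i)) ltnS ltn_ord.
Qed.

Lemma syn_auxseq (n : nat) (S : n.-tuple 'Z_3) : (0 < n)%N ->
  syn (auxseq S) = (weight S %% n)%N.
Proof.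
move=> n0; rewrite /syn /weight size_tuple prednK //; congr (_ %% _)%N.
by apply: eq_bigr => i _; rewrite tnth_mktuple.
Qed.

(* The last symbol may depend on the message only, so that the comparison with
   a symbol appended later shifts the syndrome by a constant. *)
Definition tunable (m L K : nat) : Prop :=
  exists (I : finType) (c : I -> nat) (e : I -> 'Z_3)
         (f : I -> nat -> 'Z_3 -> seq 'Z_3),
  [/\ #|I| = K,
      forall k v r k' v' r', f k v r = f k' v' r' -> k = k' &
      forall k v r, (v < L)%N ->
        [/\ size (f k v r) = m, last 0%R (f k v r) = e k,
            weight (f k v r) = (c k + v)%N & \sum_(s <- f k v r) s = r]].

(** Row [v], column [r]: a word of weight [4 + v] and sum [r] ending in 0. *)
Definition base_word (v : nat) (r : 'Z_3) : seq 'Z_3 :=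
  nth [::] (nth [::]
   [:: [:: [:: 0;2;1;2;1;0]; [:: 0;1;0;2;1;0]; [:: 0;2;0;2;1;0]];
       [:: [:: 1;0;2;2;1;0]; [:: 0;2;1;0;1;0]; [:: 0;2;1;0;2;0]];
       [:: [:: 0;0;0;2;1;0]; [:: 0;0;1;2;1;0]; [:: 0;0;2;2;1;0]];
       [:: [:: 0;0;1;0;2;0]; [:: 0;0;2;0;2;0]; [:: 0;0;1;0;1;0]];
       [:: [:: 0;0;2;1;0;0]; [:: 0;1;0;1;2;0]; [:: 0;1;0;0;1;0]];
       [:: [:: 0;1;0;2;0;0]; [:: 0;2;0;2;0;0]; [:: 0;1;0;1;0;0]];
       [:: [:: 0;0;0;1;2;0]; [:: 0;0;0;0;1;0]; [:: 0;0;0;0;2;0]];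
       [:: [:: 0;0;1;2;0;0]; [:: 0;0;0;1;0;0]; [:: 0;0;0;2;0;0]]] v) r.

Lemma tunable_base : tunable 6 8 1.
Proof.
exists unit, (fun=> 4%N), (fun=> 0), (fun=> base_word).
split=> [|[] ? ? []//|_ v r]; first by rewrite card_unit.
do 8?[case: v => [_|v] //];
  case: r => [[|[|[|r]]] hr] //; split=> //;
  rewrite /base_word /weight /= ?(big_ord_recl, big_ord0, big_cons, big_nil) //;
  exact/val_inj.
Qed.

Lemma tunable_free (m L K : nat) : (0 < m)%N ->
  tunable m L K -> tunable m.+1 L (K * 3).
Proof.
move=> m0 [I [c [e [f [cI finj fP]]]]].
exists (I * 'Z_3)%type, (fun k : I * 'Z_3 => c k.1 + m * (e k.1 <= k.2))%N, snd,
  (fun k v r => rcons (f k.1 v (r - k.2)) k.2).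
split=> [|[k s] v r [k' s'] v' r'|[k s] v r hv] /=.
- by rewrite card_prod cI card_ord.
- by move=> /rcons_inj[/finj -> ->].
have [sz la we su] := fP k v (r - s) hv.
split; rewrite ?size_rcons ?last_rcons ?sz //.
- by rewrite weight_rcons sz // la we addnAC.
- by rewrite -cats1 big_cat big_seq1 su /= subrK.
Qed.

Lemma tunable_block (m L K : nat) : (0 < m)%N -> (m.+1 <= L)%N ->
  tunable m L K -> tunable m.+3 (L + m.+1) (K * 4).
Proof.
move=> m0 mL [I [c [e [f [cI finj fP]]]]].
pose p (b : bool * bool) : 'Z_3 := if b.1 then 1 else 2.
pose q (b : bool * bool) : 'Z_3 := if b.2 then 2 else if b.1 then 1 else 0.
pose x (b : bool * bool) (d : bool) : 'Z_3 :=
  if b.1 then (if d then 1 else 0) else (if d then 2 else 1).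
have px b d : (p b <= x b d)%N = d by case: b d => [[] []] [].
have xq b d : (x b d <= q b)%N = b.1 || b.2 by case: b d => [[] []] [].
exists (I * (bool * bool))%type,
  (fun k : I * (bool * bool) =>
     c k.1 + m * (e k.1 <= p k.2) + m.+2 * (k.2.1 || k.2.2))%N,
  (fun k => q k.2),
  (fun k v r => rcons (rcons (rcons
     (f k.1 (v - (L <= v) * m.+1)%N (r - p k.2 - x k.2 (L <= v)%N - q k.2))
     (p k.2)) (x k.2 (L <= v)%N)) (q k.2)).
split=> [|[k b] v r [k' b'] v' r'|[k b] v r hv] /=.
- by rewrite !card_prod cI card_bool.
(* The pair [(p, q)] alone determines [b]; [x] varies with [v], so it carries no message. *)
- move=> /rcons_inj[/rcons_inj[/rcons_inj[/finj -> ep _ eq]]].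
  by congr pair; case: b b' ep eq => [[] []] [[] []].
set d := (L <= v)%N; set v1 := (v - d * m.+1)%N; set r1 := r - _ - _ - _.
(* If [L <= v], the comparison [p <= x] supplies [m.+1]; as [m.+1 <= L], the subtraction is
   exact. *)
have hv1 : (v1 < L)%N by rewrite /v1 /d; case: leqP => /=; lia.
have ev : v = (v1 + m.+1 * d)%N by rewrite /v1 /d; case: leqP => /=; lia.
have [sz la we su] := fP k v1 r1 hv1.
split; rewrite ?size_rcons ?last_rcons ?sz //.
- rewrite !weight_rcons ?size_rcons ?sz // !last_rcons px xq la we [in RHS]ev.
  ring.
- by rewrite -!cats1 !big_cat !big_seq1 su /= /r1; ring.
Qed.

(** Counts [u] blocks and [e] free symbols after the six initial ones. *)
Definition reach (m L u : nat) : Prop :=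
  exists2 e, m = (6 + 3 * u + e)%N & tunable m L (4 ^ u * 3 ^ e).

Lemma reach_free (m m' L u : nat) : (m <= m')%N -> reach m L u -> reach m' L u.
Proof.
move=> /subnK <-; elim: (m' - m)%N => [|d IH] // /IH[e em tu].
exists e.+1; first lia.
by rewrite addSn expnSr mulnA; apply: tunable_free => //; lia.
Qed.

Lemma reach_block (m L u : nat) : (m.+1 <= L)%N ->
  reach m L u -> reach m.+3 (L + m.+1) u.+1.
Proof.
move=> mL [e em tu]; exists e; first lia.
by rewrite expnSr mulnAC; apply: tunable_block => //; lia.
Qed.

(** Padding to length [2 ^ j.+3 - 1] puts the middle of the next block at index [2 ^ j.+3], which
    doubles [L]. *)
Lemma reach_pow2 (j : nat) : reach (2 ^ j.+2 + 2) (2 ^ j.+3) j.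
Proof.
elim: j => [|j IH]; first by exists 0%N => //; exact: tunable_base.
have e1 : (2 ^ j.+3 = 2 * 2 ^ j.+2)%N by rewrite expnS.
have e2 : (2 ^ j.+4 = 2 * 2 ^ j.+3)%N by rewrite expnS.
have h : (4 <= 2 ^ j.+2)%N by rewrite !expnS; have := expn_gt0 2 j; lia.
have /reach_block : reach (2 ^ j.+3).-1 (2 ^ j.+3) j.
  by apply: reach_free IH; lia.
rewrite prednK; last lia.
move=> /(_ (leqnn _)).
by rewrite addnn -mul2n -e2; apply: reach_free; lia.
Qed.

Lemma reach_length (n u : nat) : (6 <= n)%N -> up_log 2 n = u.+3 ->
  exists2 L, (n <= L)%N & reach n L u.
Proof.
move=> hn eu.
have n1 : (1 < n)%N by lia.
have /andP[] := up_log_bounds (isT : (1 < 2)%N) n1; rewrite eu /= => lo hi.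
have [hn2|hn2] := leqP (2 ^ u.+2 + 2) n.
  by exists (2 ^ u.+3)%N => //; apply: reach_free hn2 (reach_pow2 u).
(* Here [n = 2^(u+2) + 1], too short for a block centred at index [2^(u+2)];
   the last block is centred one index earlier. *)
case: u eu lo hi hn2 => [|u] eu lo hi hn2; first by lia.
have e1 : (2 ^ u.+3 = 2 * 2 ^ u.+2)%N by rewrite expnS.
have h : (4 <= 2 ^ u.+2)%N by rewrite !expnS; have := expn_gt0 2 u; lia.
have /reach_block : reach (n - 3) (2 ^ u.+3) u.
  by apply: reach_free (reach_pow2 u); lia.
have -> : (n - 3).+3 = n by lia.
have hL : (n - 3 < 2 ^ u.+3)%N by lia.
by move=> /(_ hL) R; exists (2 ^ u.+3 + (n - 3).+1)%N => //; lia.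
Qed.

Lemma tunable_card (n L K a : nat) (b : 'Z_3) : (a < n)%N -> (n <= L)%N ->
  tunable n L K -> (K <= #|VT n a b|)%N.
Proof.
move=> an nL [I [c [e [f [<- finj fP]]]]].
have n0 : (0 < n)%N by lia.
(* The residue of [a - c k] modulo [n], avoiding truncation. *)
pose v k := ((a + (n - c k %% n)) %% n)%N.
have vL k : (v k < L)%N by apply: leq_trans nL; rewrite ltn_mod.
have sz k : size (f k (v k) b) == n by have [/eqP] := fP k _ b (vL k).
pose g k : n.-tuple 'Z_3 := Tuple (sz k).
have ginj : injective g by move=> k k' /(congr1 val) /finj.
rewrite -(card_imset predT ginj); apply/subset_leq_card/subsetP.
move=> _ /imsetP[k _ ->].
have [_ _ we su] := fP k _ b (vL k).
rewrite inE /modsum su eqxx andbT syn_auxseq // we /v.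
rewrite -modnDml modnDmr addnCA subnKC; last by rewrite ltnW // ltn_mod.
by rewrite modnDr modn_small.
Qed.

(* up_log 2 n is the ceiling of log_2 n. The bound is stated in rat, with
   exponents in int, so that no subtraction is truncated. *)
Theorem mainTheorem5 (n : nat) (hn : (6 <= n)%N) (t : nat)
  (ht : t = up_log 2 n) (a : nat) (ha : (a <= n - 1)%N) (b : 'Z_3) :
  (2%:Q ^ (2 * (t%:Z - 3)) * 3%:Q ^ (n%:Z - 3 * t%:Z + 3)
    <= #|VT n a b|%:R :> rat).
Proof.
have t3 : (3 <= t)%N.
  by rewrite ht; apply: (leq_trans (_ : 3 <= up_log 2 6)%N) => //;
    exact: leq_up_log.
have [u tu] : exists u, t = u.+3 by exists (t - 3)%N; lia.
have [L nL [e en]] := reach_length n u hn (etrans (esym ht) tu).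
rewrite tu => /(tunable_card _ _ _ a b _ nL) K.
have -> : 2 * (u.+3%:Z - 3) = (2 * u)%N%:Z by lia.
have -> : n%:Z - 3 * u.+3%:Z + 3 = e%:Z by lia.
by rewrite -!exprnP exprM -!natrX -natrM Num.Theory.ler_nat; apply: K; lia.
Qed.
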